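(* Let $E$ be a Banach space. Then $E$ is the isometric dual of a Banach space (i.e. there is a Banach space $E_*$ with $(E_* )^*\cong E$) if and only if there exist a Banach space $Z$ and a continuous embedding $V:E\to Z^*$ such that $V$ is an isometric isomorphism between $E$ and $V(E)$ and $V(E)$ is weak-star closed in $Z^*$. In this case, the space $E_*=Z/({}^\perp V(E))$ is such an isometric predual, i.e. $\left(Z/({}^\perp V(E))\right)^*\cong E$.
   Context: All Banach spaces are real. $\cong$ denotes isometric isomorphism of Banach spaces. For a subspace $Y\subset Z^*$, ${}^\perp Y=\{z\in Z:\langle y,z\rangle=0\ \ \forall y\in Y\}$ is the subset of $Z$ of elements annihilating $Y$; the quotient $Z/({}^\perp Y)$ carries the quotient norm. The weak-star topology on $Z^*$ is $\sigma(Z^*,Z)$. *)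

(* Defs.v *)
From HB Require Import structures.
From mathcomp Require Import all_boot all_order all_algebra generic_quotient.
From mathcomp Require Import all_classical all_reals all_analysis.
Import numFieldNormedType.Exports.
Import Order.TTheory GRing.Theory Num.Theory.

Set Implicit Arguments.
Unset Strict Implicit.
Unset Printing Implicit Defensive.

Local Open Scope classical_set_scope.
Local Open Scope ring_scope.

(* The topological dual of Z with the operator norm; R^o is R viewed as a
   normed module over itself. *)
Section dual_def.
Context {R : realType} (Z : normedModType R).

Definition continuous_functional : {pred Z -> R^o} :=
  [pred f : Z -> R^o | `[< linear f /\ continuous f >]].

Lemma continuous_functional_submod : submod_closed continuous_functional.
Proof.
split.
  apply/asboolP; split; first by move=> a x y /=; rewrite scaler0 addr0.
  by move=> x; exact: cvg_cst.
move=> a f g /asboolP[lf cf] /asboolP[lg cg]; apply/asboolP; split.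
  move=> b x y; rewrite !fctE lf lg !scalerDr !scalerA mulrC.
  by rewrite addrACA.
move=> x; apply: cvgD; last exact: cg.
by apply: cvgZl_tmp; exact: cf.
Qed.

HB.instance Definition _ := GRing.isSubmodClosed.Build R (Z -> R^o)
  continuous_functional continuous_functional_submod.

Record dual := Dual {
  dual_fun :> Z -> R^o;
  dual_funP : dual_fun \in continuous_functional }.

HB.instance Definition _ := [isSub for dual_fun].
HB.instance Definition _ := [Choice of dual by <:].
HB.instance Definition _ := [SubChoice_isSubLmodule of dual by <:].

Implicit Types (f g : dual) (x : Z).

Lemma dual_linear f : linear f.
Proof. by have /asboolP[] := dual_funP f. Qed.

Lemma dual_continuous f : continuous f.
Proof. by have /asboolP[] := dual_funP f. Qed.

HB.instance Definition _ f :=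
  GRing.isLinear.Build R Z R^o *:%R (dual_fun f) (dual_linear f).

Lemma dualD f g x : (f + g) x = f x + g x. Proof. by []. Qed.
Lemma dualN f x : (- f) x = - f x. Proof. by []. Qed.
Lemma dualZ (a : R) f x : (a *: f) x = a * f x. Proof. by []. Qed.
Lemma dual0 x : (0 : dual) x = 0. Proof. by []. Qed.

Lemma dualP f g : (forall x, f x = g x) -> f = g.
Proof. by move=> fg; apply/val_inj/funext. Qed.

Definition dual_norm f : R := sup [set `|f x| | x in [set x : Z | `|x| <= 1]].

Lemma dual_bounded f : exists2 M : R, 0 < M & forall x, `|f x| <= M * `|x|.
Proof.
have /linear_bounded_continuous/linear_boundedP := @dual_continuous f.
by move=> /pinfty_ex_gt0[M M0 fM]; exists M.
Qed.

Lemma dual_norm_has_sup f :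
  has_sup [set `|f x| | x in [set x : Z | `|x| <= 1]].
Proof.
split; first by exists `|f 0|, 0 => //=; rewrite normr0 ler01.
have [M M0 fM] := dual_bounded f; exists M => _ [x /= x1 <-].
by rewrite (le_trans (fM x))// ler_piMr// ltW.
Qed.

Lemma dual_norm_ge0 f : 0 <= dual_norm f.
Proof.
apply: (le_trans (normr_ge0 (f 0))).
by apply: ub_le_sup; [case: (dual_norm_has_sup f)|
  exists 0 => //=; rewrite normr0 ler01].
Qed.

Lemma ler_dual_norm f x : `|f x| <= dual_norm f * `|x|.
Proof.
have [->|x0] := eqVneq x 0; first by rewrite linear0 !normr0 mulr0.
have nx0 : 0 < `|x| by rewrite normr_gt0.
rewrite -ler_pdivrMr// mulrC -[X in X * _]ger0_norm ?invr_ge0// -normrM.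
rewrite -[_ * _]/(_ *: _) -linearZ; apply: ub_le_sup.
  by case: (dual_norm_has_sup f).
by exists (`|x|^-1 *: x) => //=; rewrite normrZ ger0_norm ?invr_ge0// mulVf ?gt_eqF.
Qed.

Lemma dual_norm_le f (M : R) : 0 <= M -> (forall x, `|f x| <= M * `|x|) ->
  dual_norm f <= M.
Proof.
move=> M0 fM; apply: ge_sup; first by case: (dual_norm_has_sup f).
by move=> _ [x /= x1 <-]; rewrite (le_trans (fM x))// ler_piMr.
Qed.

Lemma dual_normD f g : dual_norm (f + g) <= dual_norm f + dual_norm g.
Proof.
apply: dual_norm_le => [|x]; first by rewrite addr_ge0// dual_norm_ge0.
by rewrite dualD (le_trans (ler_normD _ _))// mulrDl lerD// ler_dual_norm.
Qed.

Lemma dual_normZ (a : R) f : dual_norm (a *: f) = `|a| * dual_norm f.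
Proof.
have le b g : dual_norm (b *: g) <= `|b| * dual_norm g.
  apply: dual_norm_le => [|x]; first by rewrite mulr_ge0// dual_norm_ge0.
  by rewrite dualZ normrM -mulrA ler_wpM2l// ler_dual_norm.
apply/eqP; rewrite eq_le le /=; have [->|a0] := eqVneq a 0.
  by rewrite normr0 mul0r dual_norm_ge0.
rewrite -ler_pdivlMl ?normr_gt0// -normfV.
by rewrite -{1}[f](@scalerK _ _ a)// le.
Qed.

Lemma dual_norm_eq0 f : dual_norm f = 0 -> f = 0.
Proof.
move=> f0; apply: dualP => x; apply/eqP.
by have := ler_dual_norm f x; rewrite f0 mul0r normr_le0.
Qed.

HB.instance Definition _ :=
  @Lmodule_isNormed.Build R dual dual_norm dual_normD dual_normZ dual_norm_eq0.

Lemma dual_normE f :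
  `|f| = sup [set `|f x| | x in [set x : Z | `|x| <= 1]].
Proof. by []. Qed.

Lemma dual_complete (F : set_system dual) :
  ProperFilter F -> cauchy F -> cvg F.
Proof.
move=> FF /cauchy_ballP Fc.
have Fc' e : 0 < e -> \forall f & g \near F, `|f - g| < e.
  by move=> /Fc; apply: filterS => -[f g]; rewrite /= -ball_normE.
pose ev x : set_system R := (fun f : dual => f x : R) @ F.
have evc x : cvg (ev x).
  apply/cauchy_cvgP/cauchy_ballP => e e0; rewrite !near_simpl near_map2.
  have d0 : 0 < e / (`|x| + 1) by rewrite divr_gt0// ltr_wpDl.
  apply: filterS (Fc' _ d0) => -[f g] /= fg; rewrite -ball_normE /=.
  have -> : (f x : R) - g x = (f - g) x by [].
  rewrite (le_lt_trans (ler_dual_norm _ _))//.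
  move: fg; rewrite ltr_pdivlMr ?ltr_wpDl//; apply: le_lt_trans.
  by rewrite ler_wpM2l ?dual_norm_ge0// lerDl.
pose l x : R^o := lim (ev x).
have ll : linear l.
  move=> a x y; apply/cvg_lim => //.
  apply: (@cvg_trans _ ((fun f : dual => a * f x + f y : R) @ F)).
    by apply: near_eq_cvg; apply: nearW => f /=; rewrite linearP.
  by apply: cvgD; [apply: cvgMl_tmp|]; exact: evc.
have lim_le f (e : R) : 0 < e -> (\forall g \near F, `|f - g| < e) ->
    forall x, `|(f x : R) - l x| <= e * `|x|.
  move=> e0 fe x.
  have fgl : (fun g : dual => `|(f x : R) - g x|) @ F --> `|(f x : R) - l x|.
    by apply: cvg_norm; apply: cvgB; [exact: cvg_cst|exact: evc].
  apply: (cvgr_to_le fgl); apply: filterS fe => g fg.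
  have -> : (f x : R) - g x = (f - g) x by [].
  by rewrite (le_trans (ler_dual_norm _ _))// ler_wpM2r//; exact: ltW.
have Fe e : 0 < e -> \forall f \near F, \forall g \near F, `|f - g| < e.
  by move=> /Fc'/nearP_dep.
have lin_l : GRing.linear_for *:%R l by exact: ll.
pose L : {linear Z -> R^o} :=
  HB.pack l (GRing.isLinear.Build R Z R^o *:%R l lin_l).
have cl : continuous l.
  have [f fF] := filter_ex (Fe 1 ltr01).
  have fl := lim_le f 1 ltr01 fF.
  suff : continuous L by [].
  apply/linear_bounded_continuous/linear_boundedP.
  apply: filterS (nbhs_pinfty_ge (num_real (dual_norm f + 1))) => M fM x /=.
  have -> : l x = f x - (f x - l x) by rewrite opprB addrC subrK.
  rewrite (le_trans (ler_normB _ _))//.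
  by rewrite (le_trans (lerD (ler_dual_norm f x) (fl x)))// -mulrDl ler_wpM2r.
have lP : l \in continuous_functional by apply/asboolP.
apply/cvg_ex; exists (Dual lP); apply/cvgrPdist_le => e e0.
apply: filterS (Fe e e0) => f fF.
rewrite distrC; apply: dual_norm_le; first exact: ltW.
by move=> x; exact: lim_le.
Qed.

HB.instance Definition _ := Uniform_isComplete.Build dual dual_complete.

End dual_def.

(* The carrier of dual Z with sigma(Z^*, Z), the topology of pointwise
   convergence on Z, instead of the norm topology. *)
Section weak_star_def.
Context {R : realType} (Z : normedModType R).

Definition weak_star : Type :=
  initial_topology (fun f : dual Z => (f : {ptws Z -> R^o})).

HB.instance Definition _ := Topological.on weak_star.

End weak_star_def.

(* Closedness makes the quotient seminorm a norm. *)
Record closed_subspace (R : realType) (Z : normedModType R) := ClosedSubspace {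
  subspace_set :> set Z;
  subspace0 : subspace_set 0;
  subspaceP : forall (a : R) (x y : Z),
    subspace_set x -> subspace_set y -> subspace_set (a *: x + y);
  subspace_closed : closed subspace_set }.

Section quotient_def.
Local Open Scope quotient_scope.
Context {R : realType} {Z : normedModType R} (N : closed_subspace Z).

Definition subspace_pred : {pred Z} := [pred x | `[< subspace_set N x >]].

Lemma subspace_pred_submod : submod_closed subspace_pred.
Proof.
split; first by apply/asboolP; exact: subspace0.
by move=> a x y /asboolP Nx /asboolP Ny; apply/asboolP; exact: subspaceP.
Qed.

HB.instance Definition _ :=
  GRing.isSubmodClosed.Build R Z subspace_pred subspace_pred_submod.

Definition quotient_space : Type := Quotient.quot subspace_pred.

HB.instance Definition _ := GRing.Zmodule.on quotient_space.

Definition quotient_map (x : Z) : quotient_space := \pi_(Quotient.quot subspace_pred) x.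
Local Notation pi := quotient_map.

Lemma quotient_mapP x y : pi x = pi y <-> subspace_set N (x - y).
Proof.
have E := Quotient.idealrBE subspace_pred x y; split => [xy|Nxy].
  by move: E; rewrite (introT eqP xy) => /asboolP.
by apply/eqP; rewrite -E; apply/asboolP.
Qed.

Lemma quotient_map_surj q : exists x, pi x = q.
Proof. by exists (repr (q : Quotient.quot subspace_pred)); exact: reprK. Qed.

Lemma quotient_mapD : {morph pi : x y / x + y}.
Proof. by move=> x y; rewrite /pi !piE. Qed.

Definition quotient_scale (a : R) (q : quotient_space) : quotient_space :=
  pi (a *: repr (q : Quotient.quot subspace_pred)).

Lemma quotient_scale_map a x : quotient_scale a (pi x) = pi (a *: x).
Proof.
apply/quotient_mapP; rewrite -scalerBr -[_ *: _]addr0.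
by apply: subspaceP; [apply/quotient_mapP; exact: reprK|exact: subspace0].
Qed.

Lemma quotient_scaleA a b q :
  quotient_scale a (quotient_scale b q) = quotient_scale (a * b) q.
Proof.
by have [x <-] := quotient_map_surj q; rewrite !quotient_scale_map scalerA.
Qed.

Lemma quotient_scale1 : left_id 1 quotient_scale.
Proof.
by move=> q; have [x <-] := quotient_map_surj q;
  rewrite quotient_scale_map scale1r.
Qed.

Lemma quotient_scaleDr : right_distributive quotient_scale +%R.
Proof.
move=> a p q; have [x <-] := quotient_map_surj p.
have [y <-] := quotient_map_surj q.
by rewrite -quotient_mapD !quotient_scale_map scalerDr quotient_mapD.
Qed.

Lemma quotient_scaleDl q : {morph quotient_scale^~ q : a b / a + b}.
Proof.
move=> a b; have [x <-] := quotient_map_surj q.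
by rewrite !quotient_scale_map scalerDl quotient_mapD.
Qed.

HB.instance Definition _ := GRing.Zmodule_isLmodule.Build R quotient_space
  quotient_scaleA quotient_scale1 quotient_scaleDr quotient_scaleDl.

Lemma quotient_map_linear : linear pi.
Proof. by move=> a x y; rewrite quotient_mapD -quotient_scale_map. Qed.

HB.instance Definition _ :=
  GRing.isLinear.Build R Z quotient_space *:%R pi quotient_map_linear.

Definition quotient_norm (q : quotient_space) : R :=
  inf [set `|x| | x in [set x : Z | pi x = q]].

Lemma quotient_norm_has_inf q : has_inf [set `|x| | x in [set x : Z | pi x = q]].
Proof.
split; first by have [x xq] := quotient_map_surj q; exists `|x|, x.
by exists 0 => _ [x _ <-].
Qed.

Lemma quotient_norm_ge0 q : 0 <= quotient_norm q.
Proof.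
by apply: lb_le_inf; [case: (quotient_norm_has_inf q)|move=> _ [x _ <-]].
Qed.

Lemma quotient_norm_le x : quotient_norm (pi x) <= `|x|.
Proof. by apply: ge_inf; [case: (quotient_norm_has_inf (pi x))|exists x]. Qed.

Lemma quotient_norm_lt q e :
  quotient_norm q < e -> exists2 x, pi x = q & `|x| < e.
Proof.
by move=> /(inf_lt (quotient_norm_has_inf q).1)[_ [x xq <-] xe]; exists x.
Qed.

Lemma quotient_normD p q :
  quotient_norm (p + q) <= quotient_norm p + quotient_norm q.
Proof.
apply/ler_addgt0Pr => e e0; have e20 : 0 < e / 2 by rewrite divr_gt0.
have [x xp xe] : exists2 x, pi x = p & `|x| < quotient_norm p + e / 2.
  by apply: quotient_norm_lt; rewrite ltrDl.
have [y yq ye] : exists2 y, pi y = q & `|y| < quotient_norm q + e / 2.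
  by apply: quotient_norm_lt; rewrite ltrDl.
rewrite [e]splitr addrACA -xp -yq -quotient_mapD.
rewrite (le_trans (quotient_norm_le _))// (le_trans (ler_normD _ _))//.
by rewrite lerD// ?xp ?yq ltW.
Qed.

Lemma quotient_normZ (a : R) q :
  quotient_norm (a *: q) = `|a| * quotient_norm q.
Proof.
have le b p : quotient_norm (b *: p) <= `|b| * quotient_norm p.
  have [->|b0] := eqVneq b 0.
    rewrite scale0r normr0 mul0r -(linear0 pi).
    by rewrite (le_trans (quotient_norm_le _))// normr0.
  rewrite -ler_pdivrMl ?normr_gt0//; apply: lb_le_inf.
    by case: (quotient_norm_has_inf p).
  move=> _ [x /= <- <-]; rewrite ler_pdivrMl ?normr_gt0// -normrZ -linearZ.
  exact: quotient_norm_le.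
apply/eqP; rewrite eq_le le /=; have [->|a0] := eqVneq a 0.
  by rewrite normr0 mul0r quotient_norm_ge0.
rewrite -ler_pdivlMl ?normr_gt0// -normfV.
by rewrite -{1}[q](@scalerK _ _ a)// le.
Qed.

Lemma quotient_norm_eq0 q : quotient_norm q = 0 -> q = 0.
Proof.
have [x <-] := quotient_map_surj q => x0.
rewrite -(linear0 pi); apply/quotient_mapP; rewrite subr0.
apply: (@subspace_closed _ _ N x) => B /nbhs_ballP[e /= e0 xB].
have [y yx ye] : exists2 y, pi y = pi x & `|y| < e.
  by apply: quotient_norm_lt; rewrite x0.
exists (x - y); split; first exact/quotient_mapP.
by apply: xB; rewrite -ball_normE /= opprB addrC subrK.
Qed.

HB.instance Definition _ := @Lmodule_isNormed.Build R quotient_space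
  quotient_norm quotient_normD quotient_normZ quotient_norm_eq0.

Lemma quotient_normE q :
  `|q| = inf [set `|x| | x in [set x : Z | pi x = q]].
Proof. by []. Qed.

End quotient_def.

Section quotient_complete.
Context {R : realType} {Z : completeNormedModType R} (N : closed_subspace Z).
Local Notation Q := (quotient_space N).
Local Notation pi := (quotient_map N).

Lemma quotient_complete (F : set_system Q) :
  ProperFilter F -> cauchy F -> cvg F.
Proof.
move=> FF /cauchyP Fc; pose d n : R := 2^-1 ^+ n.
have d0 n : 0 < d n by rewrite exprn_gt0.
have [q Fq] : {q : nat -> Q & forall n, F (ball (q n) (d n))}.
  by apply: (@choice _ _ (fun n q => F (ball q (d n)))) => n; exact: Fc.
have qS n : `|q n.+1 - q n| < 2 * d n.
  have [p []] := filter_ex (filterI (Fq n) (Fq n.+1)).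
  rewrite -ball_normE /= => np Snp.
  rewrite -[q n.+1](subrK p) -addrA (le_lt_trans (ler_normD _ _))//.
  rewrite mulr_natl mulr2n ltrD//; last by rewrite distrC.
  apply: lt_le_trans Snp _; rewrite /d exprS.
  by apply: ler_piMl; [exact: ltW|rewrite invf_le1 ?ler1n].
have [v vq] : {v : nat -> Z &
    forall n, pi (v n) = q n.+1 - q n /\ `|v n| < 2 * d n}.
  apply: (@choice _ _ (fun n w => pi w = q n.+1 - q n /\ `|w| < 2 * d n)) => n.
  by have [w] := quotient_norm_lt (qS n); exists w.
have [x0 x0q] := quotient_map_surj (q 0%N).
have piq n : pi (x0 + series v n) = q n.
  elim: n => [|n IH]; first by rewrite /series /= big_geq// addr0.
  by rewrite seriesSr addrA quotient_mapD IH (vq n).1 addrC subrK.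
have cv : cvgn (series v).
  apply: normed_cvg; apply: (@series_le_cvg _ _ (geometric 2 2^-1)) => //.
  - by move=> n; exact: normr_ge0.
  - by move=> n; rewrite /geometric /= mulr_ge0// ltW.
  - by move=> n; rewrite /geometric /= ltW// (vq n).2.
  - by apply: is_cvg_geometric_series; rewrite ger0_norm// invf_lt1 ?ltr1n.
pose s := limn (series v).
apply/cvg_ex; exists (pi (x0 + s)); apply/cvgrPdist_lt => e e0.
have e20 : 0 < e / 2 by rewrite divr_gt0.
have [n [sn dn]] : exists n, `|s - series v n| < e / 2 /\ d n < e / 2.
  have dcv : d @ \oo --> 0.
    by apply: cvg_expr; rewrite ger0_norm// invf_lt1 ?ltr1n.
  have sv : \forall n \near \oo, `|s - series v n| < e / 2.
    by move/cvgrPdist_lt : cv; apply.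
  have dv : \forall n \near \oo, d n < e / 2 by exact: cvgr_lt dcv _ e20.
  by have [n []] := filter_ex (filterI sv dv); exists n.
apply: filterS (Fq n) => p; rewrite -ball_normE /= => np.
rewrite -[pi _](subrK (q n)) -addrA (le_lt_trans (ler_normD _ _))//.
rewrite [e]splitr ltrD//; last exact: lt_trans np dn.
rewrite -[in X in X < _](piq n) -linearB opprD addrACA subrr add0r.
exact: le_lt_trans (quotient_norm_le _ _) sn.
Qed.

HB.instance Definition _ := Uniform_isComplete.Build Q quotient_complete.

End quotient_complete.

Section predual.
Context {R : realType} {Z : normedModType R} (Y : set (dual Z)).

Definition pre_annihilator_set : set Z :=
  [set z | forall y : dual Z, Y y -> y z = 0].

Lemma pre_annihilator0 : pre_annihilator_set 0.
Proof. by move=> y _; rewrite linear0. Qed.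

Lemma pre_annihilatorP (a : R) (u v : Z) :
  pre_annihilator_set u -> pre_annihilator_set v ->
  pre_annihilator_set (a *: u + v).
Proof. by move=> u0 v0 y Yy; rewrite linearP /= u0// v0// scaler0 addr0. Qed.

Lemma pre_annihilator_closed : closed pre_annihilator_set.
Proof.
have -> : pre_annihilator_set = \bigcap_(y in Y) (y @^-1` [set 0]) by [].
apply: closed_bigI => y _; apply: preimage_closed; last exact: closed_eq.
by move=> z _; exact: dual_continuous.
Qed.

Definition pre_annihilator : closed_subspace Z :=
  ClosedSubspace pre_annihilator0 pre_annihilatorP pre_annihilator_closed.

End predual.

Section isometries.
Context {R : realType}.

Definition isometric_isomorphism_onto (E F : normedModType R)
    (T : {linear E -> F}) (A : set F) : Prop :=
  set_bij [set: E] A T /\ forall x, `|T x| = `|x|.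

Definition isometrically_isomorphic (E F : normedModType R) : Prop :=
  exists T : {linear E -> F}, isometric_isomorphism_onto T [set: F].

Definition isometric_predual (E Estar : completeNormedModType R) : Prop :=
  isometrically_isomorphic (dual Estar) E.

Definition weak_star_closed (Z : normedModType R) (A : set (dual Z)) : Prop :=
  @closed (weak_star Z) A.

Definition weak_star_closed_embedding (E Z : completeNormedModType R)
    (V : {linear E -> dual Z}) : Prop :=
  [/\ continuous V,
      isometric_isomorphism_onto V (range V) &
      weak_star_closed (range V)].

End isometries.

(* Main.v *)
Require Import Defs.
From HB Require Import structures.
From mathcomp Require Import all_boot all_order all_algebra.
From mathcomp Require Import all_classical all_reals all_analysis.
Import numFieldNormedType.Exports.
Import Order.TTheory GRing.Theory Num.Theory.

(** The substance is the equality [(^perp A)^perp = A] for a weak-star closed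
    subspace [A] of [Z^*], and it reduces to finite-dimensional linear algebra.
    A weak-star neighbourhood of [f] only tests finitely many points of [Z],
    and on finitely many points a functional vanishing on [^perp A] coincides
    exactly with an element of [A] ([interpolation]), by elimination of one
    point at a time. Hence such an [f] is in the weak-star closure of [A]
    ([weak_star_closed_bipolar]).

    Let [N = ^perp V(E)] and let [pi] be the projection of [Z] onto [Z / N].
    Precomposition with [pi] is an isometry of [(Z / N)^*] into [Z^*], and its
    range is the set of functionals vanishing on [N], which is therefore
    [V(E)].  The spaces [(Z / N)^*] and [E] are thus isometric to the same
    subspace of [Z^*], hence to each other ([isometric_same_range]).
    Conversely, if [E] is isometric to the dual of [E_*], then [Z = E_*] works,
    with [V] the isometry of [E] onto the whole of [Z^*], which is trivially
    closed. *)

Set Implicit Arguments.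
Unset Strict Implicit.
Unset Printing Implicit Defensive.

Local Open Scope classical_set_scope.
Local Open Scope ring_scope.

(** * Linear isometries *)

Section linear_isometries.
Context {R : realType}.

Lemma linear_isometry_inj (E F : normedModType R) (V : {linear E -> F}) :
  (forall x, `|V x| = `|x|) -> injective V.
Proof.
move=> Viso x y Vxy; apply/eqP; rewrite -subr_eq0 -normr_eq0 -Viso linearB.
by rewrite Vxy subrr normr0.
Qed.

Lemma linear_isometry_continuous (E F : normedModType R)
    (V : {linear E -> F}) :
  (forall x, `|V x| = `|x|) -> continuous V.
Proof.
move=> Viso; apply/linear_bounded_continuous/linear_boundedP.
apply: filterS (nbhs_pinfty_ge (num_real (1 : R))) => M M1 x.
by rewrite Viso ler_peMl.
Qed.

(** The isometry of [D] onto [E] is [V^-1 \o P]; with [P] the identity this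
    inverts a surjective isometry. *)
Lemma isometric_same_range (D E G : normedModType R)
    (P : {linear D -> G}) (V : {linear E -> G}) :
  (forall x, `|P x| = `|x|) -> (forall x, `|V x| = `|x|) ->
  range P = range V -> isometrically_isomorphic D E.
Proof.
move=> Piso Viso PV.
have /choice[t Vt] : forall d, exists e, V e = P d.
  move=> d; have [e _ eP] : range V (P d) by rewrite -PV; exists d.
  by exists e.
have tl : linear t.
  by move=> a x y; apply: (linear_isometry_inj Viso);
    rewrite linearP !Vt linearP.
pose T : {linear D -> E} :=
  HB.pack t (GRing.isLinear.Build R D E *:%R t tl).
have Tiso x : `|T x| = `|x| by rewrite -Viso [V _]Vt Piso.
exists T; split=> //; split=> //.
- by move=> x y _ _; exact: linear_isometry_inj Tiso _ _.
- move=> e _; have [d _ Pd] : range P (V e) by rewrite PV; exists e.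
  by exists d => //; apply: (linear_isometry_inj Viso); rewrite [LHS]Vt.
Qed.

End linear_isometries.

(** * Weak-star closed subspaces *)

Section bipolar.
Context {R : realType} (Z : normedModType R).
Implicit Types (A : set (dual Z)) (f g : dual Z).

Definition is_subspace A :=
  A 0 /\ forall (a : R) f g, A f -> A g -> A (a *: f + g).

(** If all of [A] vanishes at [z0], then so does [f], and [z0] imposes no
    condition. When some [g0] in [A] has [g0 z0 = 1], the point [z0] is removed
    from the list by passing to the subspace [A'] of the functionals of [A] that
    vanish at [z0], and to [f' = f - f z0 *: g0]. The latter vanishes on
    [^perp A'], since [z - g0 z *: z0] is in [^perp A] for [z] in
    [^perp A']. *)
Lemma interpolation A f (s : seq Z) : is_subspace A ->
  (forall z, pre_annihilator_set A z -> f z = 0) ->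
  exists2 g, A g & {in s, g =1 f}.
Proof.
elim: s A f => [|z0 s IH] A f [A0 AP] fA; first by exists 0.
have [Az0|] := pselect (pre_annihilator_set A z0).
  have [g Ag gf] := IH A f (conj A0 AP) fA; exists g => // z.
  rewrite inE => /orP[/eqP ->|]; last exact: gf.
  by rewrite fA // Az0.
move=> /existsNP[g1 /not_implyP[Ag1 /eqP g1z0]].
pose g0 : dual Z := (g1 z0)^-1 *: g1.
have Ag0 : A g0 by rewrite -[g0]addr0; exact: AP.
have g0z0 : g0 z0 = 1 by rewrite dualZ mulVf.
pose A' := [set g | A g /\ g z0 = 0].
have A'P : is_subspace A'.
  split; first by split.
  move=> a g h [Ag gz] [Ah hz]; split; first exact: AP.
  by rewrite dualD dualZ gz hz mulr0 addr0.
have fA' z : pre_annihilator_set A' z -> (f - f z0 *: g0) z = 0.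
  move=> A'z; rewrite dualD dualN dualZ.
  have /fA : pre_annihilator_set A (z - g0 z *: z0).
    move=> g Ag.
    have /A'z : A' (- g z0 *: g0 + g).
      split; first exact: AP.
      by rewrite dualD dualZ g0z0 mulr1 addNr.
    rewrite dualD dualZ linearB linearZ /= => <-.
    by rewrite addrC mulNr [g0 z *: _]mulrC.
  by rewrite linearB linearZ /= [g0 z *: _]mulrC.
have [g [Ag gz0] gf] := IH _ _ A'P fA'.
exists (f z0 *: g0 + g) => [|z]; first exact: AP.
rewrite inE dualD dualZ => /orP[/eqP ->|/gf ->].
  by rewrite g0z0 gz0 mulr1 addr0.
by rewrite dualD dualN dualZ addrC subrK.
Qed.

(** The elements of [A] that coincide with [f] on finite sets form a proper
    filter by interpolation, and this filter converges pointwise to [f]. *)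
Lemma weak_star_closed_bipolar A f : is_subspace A -> weak_star_closed A ->
  (forall z, pre_annihilator_set A z -> f z = 0) -> A f.
Proof.
move=> Asub Acl fA.
pose F : set_system (weak_star Z) := [set B : set (dual Z) |
  exists s : seq Z, forall g, A g -> {in s, g =1 f} -> B g].
have FF : ProperFilter F.
  split.
    move=> [s sB]; have [g Ag gf] := interpolation s Asub fA.
    exact: sB g Ag gf.
  split.
  - by exists [::].
  - move=> B C [s sB] [t tC]; exists (s ++ t) => g Ag gf; split.
      by apply: sB => // z zs; apply: gf; rewrite mem_cat zs.
    by apply: tC => // z zt; apply: gf; rewrite mem_cat zt orbT.
  - by move=> B C BC [s sB]; exists s => g Ag gf; exact/BC/sB.
have Ff : F --> (f : weak_star Z).
  have Fpt : (fun g : dual Z => (g : {ptws Z -> R^o})) @ F -->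
      (f : {ptws Z -> R^o}).
    apply/cvg_sup => z B [_ [[W oW <-] Wfz WB]].
    by exists [:: z] => g _ gf; apply: WB; rewrite /= /proj gf ?inE.
  move=> B [_ [[C oC <-] Cf CB]].
  have [s sC] := Fpt C (open_nbhs_nbhs (conj oC Cf)).
  by exists s => g Ag gf; apply: CB; exact: sC.
apply: (@closed_cvg _ _ F FF id A Acl _ _ Ff).
by exists [::] => g.
Qed.

End bipolar.

(** * The dual of a quotient *)

Section quotient_dual.
Context {R : realType}.

Lemma bounded_functionalP (Z : normedModType R) (f : Z -> R^o) (M : R) :
  linear f -> (forall x, `|f x| <= M * `|x|) ->
  f \in @continuous_functional R Z.
Proof.
move=> fl fM; apply/asboolP; split=> //.
pose g : {linear Z -> R^o} :=
  HB.pack f (GRing.isLinear.Build R Z R^o *:%R f fl).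
suff : continuous g by [].
apply/linear_bounded_continuous/linear_boundedP.
apply: filterS (nbhs_pinfty_ge (num_real M)) => K MK x.
by rewrite (le_trans (fM x))// ler_wpM2r.
Qed.

Context {Z : normedModType R} (N : closed_subspace Z).
Local Notation Q := (quotient_space N).
Local Notation pi := (quotient_map N).

Lemma ler_quotient_norm (c M : R) (q : Q) : 0 <= M ->
  (forall x, pi x = q -> c <= M * `|x|) -> c <= M * `|q|.
Proof.
rewrite le_eqVlt => /orP[/eqP <-|M0] cM.
  by have [x /cM] := quotient_map_surj q; rewrite !mul0r.
rewrite -ler_pdivrMl//; apply: lb_le_inf.
  exact: (quotient_norm_has_inf q).1.
by move=> _ [x xq <-]; rewrite ler_pdivrMl//; exact: cM.
Qed.

Lemma quotient_pullback_subproof (phi : dual Q) :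
  (phi \o pi : Z -> R^o) \in @continuous_functional R Z.
Proof.
apply: (@bounded_functionalP _ _ `|phi|) => [a x y|x] /=.
  by rewrite !linearP.
rewrite (le_trans (ler_dual_norm _ _))// ler_wpM2l ?dual_norm_ge0//.
exact: quotient_norm_le.
Qed.

Definition quotient_pullback (phi : dual Q) : dual Z :=
  Dual (quotient_pullback_subproof phi).

Lemma quotient_pullback_linear : linear quotient_pullback.
Proof. by move=> a phi psi; apply: dualP. Qed.

HB.instance Definition _ := GRing.isLinear.Build R (dual Q) (dual Z) *:%R
  quotient_pullback quotient_pullback_linear.

Lemma quotient_pullback_isometry phi : `|quotient_pullback phi| = `|phi|.
Proof.
apply/eqP; rewrite eq_le; apply/andP; split.
  apply: dual_norm_le => // x.
  rewrite (le_trans (ler_dual_norm phi (pi x)))// ler_wpM2l ?dual_norm_ge0//.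
  exact: quotient_norm_le.
apply: dual_norm_le => // q; apply: ler_quotient_norm => // x <-.
exact: ler_dual_norm (quotient_pullback phi) x.
Qed.

(** A functional vanishing on [N] is constant on the cosets of [N], and its
    common value on a coset has absolute value at most [`|f|] times the norm of
    every representative, so it descends to a bounded functional. *)
Lemma range_quotient_pullback :
  range quotient_pullback = [set f | forall z, subspace_set N z -> f z = 0].
Proof.
apply/seteqP; split=> [_ [phi _ <-] z Nz /=|f fN].
  have -> : pi z = 0.
    by rewrite -(linear0 pi); apply/quotient_mapP; rewrite subr0.
  by rewrite linear0.
have /choice[r pir] := @quotient_map_surj _ _ N.
pose phi (q : Q) : R^o := f (r q).
have phipi x : phi (pi x) = f x.
  apply/eqP; rewrite -subr_eq0 -linearB; apply/eqP/fN.
  exact/quotient_mapP.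
have phil : linear phi.
  by move=> a p q; rewrite -[p]pir -[q]pir -linearP !phipi linearP.
have phiP : phi \in @continuous_functional R Q.
  apply: (@bounded_functionalP _ _ `|f|) => // q.
  by apply: ler_quotient_norm => // x <-; rewrite phipi; exact: ler_dual_norm.
by exists (Dual phiP) => //; apply: dualP.
Qed.

End quotient_dual.

(** * Preduals *)

Lemma quotient_isometric_predual (R : realType)
    (E Z : completeNormedModType R) (V : {linear E -> dual Z}) :
  weak_star_closed_embedding V ->
  isometric_predual E (quotient_space (pre_annihilator (range V))).
Proof.
move=> [_ [_ Viso] Vcl].
pose N := pre_annihilator (range V).
apply: (isometric_same_range (@quotient_pullback_isometry _ _ N) Viso).
rewrite range_quotient_pullback; apply/seteqP; split=> f /=.
  apply: weak_star_closed_bipolar => //; split.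
    by exists 0 => //; exact: linear0.
  move=> a _ _ [x _ <-] [y _ <-].
  by exists (a *: x + y) => //; exact: linearP.
by move=> Vf z; apply.
Qed.

Theorem theorem3p1 (R : realType) (E : completeNormedModType R) :
  ((exists Estar : completeNormedModType R, isometric_predual E Estar) <->
   (exists (Z : completeNormedModType R) (V : {linear E -> dual Z}),
      weak_star_closed_embedding V)) /\
  (forall (Z : completeNormedModType R) (V : {linear E -> dual Z}),
     weak_star_closed_embedding V ->
     isometric_predual E (quotient_space (pre_annihilator (range V)))).
Proof.
split; last by move=> Z V; exact: quotient_isometric_predual.
split=> [[Z [T [[_ _ Tsurj] Tiso]]]|[Z [V VP]]]; last first.
  exists (quotient_space (pre_annihilator (range V))).
  exact: quotient_isometric_predual.
have [V [[_ _ Vsurj] Viso]] : isometrically_isomorphic E (dual Z).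
  apply: (@isometric_same_range _ _ _ _ idfun T) => //.
  by apply/seteqP; split=> e _; [exact: Tsurj|exists e].
have VT : range V = [set: dual Z] by apply/seteqP; split=> // f _; exact: Vsurj.
exists Z, V; split.
- exact: linear_isometry_continuous.
- by split=> //; split=> [x _|x y _ _|]; [exists x|exact: linear_isometry_inj|].
- by rewrite /weak_star_closed VT; exact: closedT.
Qed.
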